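(* Let $p\equiv 1\pmod 8$ be a prime and let $\alpha$ be a positive integer. Let $G^\ast(p^\alpha)$ be the Peisert-like graph of order $p^\alpha$. Then the number $k_3(G^\ast(p^\alpha))$ of cliques of order $3$ in $G^\ast(p^\alpha)$ is $$k_3(G^\ast(p^\alpha))=\frac{p^{3\alpha-2}(p-1)(p-5)}{48}.$$
   Context: Peisert-like graph: let $n=p^\alpha$ or $n=2p^\alpha$, where $p\equiv 1\pmod 8$ is a prime and $\alpha$ is a positive integer. Let $\mathbb{Z}_n=\mathbb{Z}/n\mathbb{Z}$, let $\mathbb{Z}_n^\ast$ be its (cyclic) group of units, and fix a generator $g$, so $\mathbb{Z}_n^\ast=\langle g\rangle$. The Peisert-like graph $G^\ast(n)$ is the simple undirected graph with vertex set $\mathbb{Z}_n$ in which $xy$ is an edge if and only if $x-y\in\langle g^4\rangle\cup g\langle g^4\rangle$. (The relation is symmetric since $-1\in\langle g^4\rangle$; different choices of generator $g$ give isomorphic graphs.) For a graph $G$, $k_m(G)$ denotes the number of cliques of order $m$ in $G$, i.e. the number of $m$-element sets of pairwise adjacent vertices. *)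

(* Defs.v *)
From HB Require Import structures.
From mathcomp Require Import all_boot all_order all_algebra all_fingroup all_solvable.

Set Implicit Arguments.
Unset Strict Implicit.
Unset Printing Implicit Defensive.

Import GRing.Theory.
Local Open Scope ring_scope.

Definition is_clique (T : finType) (e : rel T) (S : {set T}) : bool :=
  [forall x in S, forall y in S, (x != y) ==> e x y].

Definition nb_cliques (T : finType) (e : rel T) (m : nat) : nat :=
  #|[set S : {set T} | (#|S| == m) && is_clique e S]|.

(* The connection set <g^4> \cup g<g^4>, as a set of residues. *)
Definition peisert_set (n : nat) (g : {unit 'Z_n}) : {set 'Z_n} :=
  [set val u | u in (<[g ^+ 4]> :|: g *: <[g ^+ 4]>)%g].

(* Meaningful for 1 < n, since 'Z_0 and 'Z_1 are both Z/2Z.  When g generates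
   the units and n = p^a or 2p^a with p = 1 mod 8 prime and 0 < a, the element
   -1 lies in <g^4>, so the relation is symmetric; it is irreflexive because
   0 is not a unit. *)
Definition peisert_like (n : nat) (g : {unit 'Z_n}) : rel 'Z_n :=
  fun x y => x - y \in peisert_set g.

(* Main.v *)
Require Import Defs.
From mathcomp Require Import all_boot all_order all_algebra all_fingroup all_solvable.
From mathcomp Require Import zify ring lra.

(** Let R = Z/p^a, let C_i be the set of units g^k with k = i mod 4, and let
    S = C_0 u C_1 be the connection set.  Since S = -S, an ordered triangle
    (x, y, z) amounts to a base point x and a solution of u + v + w = 0 in S,
    with u = x - y, v = y - z, w = z - x.  As each triangle has 6 orderings,
    6 k_3 = |R| * T where T is the number of those solutions
    ([card_ordered_cliques], [card_tuple3_zero_sum]).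

    Let t(i,j,k) be the number of solutions of u + v + w = 0 with u in C_i,
    v in C_j, w in C_k.  Individually these numbers (cyclotomic numbers of
    order 4) depend on the arithmetic of p, but T does not.  They are symmetric
    in i, j, k, and multiplication by g makes them invariant under adding 1 to
    all three indices modulo 4; hence every t(i,j,k) equals one of
      A = t(0,0,0), B = t(0,0,1), C = t(0,0,2), D = t(0,0,3), E = t(0,1,2),
    and T = 2 A + 3 B + 3 D.  Summing over k counts the pairs (u, v) in
    C_i x C_j whose sum is a unit ([sum_class_triples]).  Write f = |C_i| and q
    for the number of nonunits.  The nonunits form an ideal J with q odd, so
    1 + J is a group of odd order, which lies in C_0 = <g^4>; therefore a unit
    keeps its class when a nonunit is added to it.  Also -1 lies in C_0 because
    8 divides the order of g.  So u + v can be a nonunit only when i = j, and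
    then each u has exactly q partners v.  This gives
      A + B + C + D = f^2 - f q,   B + D + 2 E = f^2,   2 C + 2 E = f^2,
    whence B + D = 2 C and T = 2 (A + 3 C) = 2 (f^2 - f q)
    ([zero_sum_peisert]).  With q = p^(a-1) and 4 f = (p - 1) q this is the
    stated value.

    The argument is carried out in any finite commutative ring whose nonunits
    are closed under addition and of odd number, and whose unit group is cyclic
    of order divisible by 8. *)

Set Implicit Arguments.
Unset Strict Implicit.
Unset Printing Implicit Defensive.

Import GRing.Theory Num.Theory.
Local Open Scope ring_scope.

(** * Ordered cliques *)

(** An m-clique has m! orderings, and every pairwise adjacent m-tuple is one of
    them: irreflexivity forces its entries to be distinct. *)
Lemma card_ordered_cliques (T : finType) (e : rel T) (m : nat) :
    symmetric e -> irreflexive e ->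
  #|[set t : m.-tuple T | pairwise e t]| = (nb_cliques e m * m`!)%N.
Proof.
move=> e_sym e_irr.
rewrite -sum1_card (partition_big (fun t : m.-tuple T => [set x in t])
   (mem [set S : {set T} | (#|S| == m) && is_clique e S])) /=; last first.
  move=> t; rewrite !inE => et.
  have t_uniq := pairwise_uniq e_irr et.
  rewrite cardsE (card_uniqP t_uniq) size_tuple eqxx /=.
  apply/forall_inP => x; rewrite inE => xt.
  apply/forall_inP => y; rewrite inE => yt; apply/implyP => neq_xy.
  (* The reflexive closure of e holds between any two entries of t, whatever
     their relative position. *)
  pose e' u v := (u == v) || e u v.
  have e'_refl : reflexive e' by move=> u; rewrite /e' eqxx.
  have e'_sym : symmetric e' by move=> u v; rewrite /e' eq_sym e_sym.
  have : pairwise e' t.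
    by apply: sub_pairwise et => u v; rewrite /e' => ->; rewrite orbT.
  rewrite (pairwise_all2rel e'_refl e'_sym) => /allrelP/(_ x y xt yt).
  by rewrite /e' (negPf neq_xy).
rewrite (eq_bigr (fun=> m`!)) ?sum_nat_const // => S.
rewrite inE => /andP[/eqP cardS /forall_inP cliqueS].
have -> : m`! = #|[set t : m.-tuple T | all (mem S) t & uniq t]|.
  by rewrite card_uniq_tuples cardS ffactnn.
rewrite sum1dep_card; apply: eq_card => t; rewrite !inE.
apply/andP/andP => [[et /eqP <-]|[/allP tS t_uniq]].
  split; last exact: pairwise_uniq et.
  by apply/allP => x xt; rewrite /= inE.
split.
  have := t_uniq; rewrite uniq_pairwise.
  apply: (@sub_in_pairwise _ (mem S)); last exact/allP.
  move=> x y xS yS /= neq_xy.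
  by have /forall_inP/(_ y yS) := cliqueS x xS; rewrite neq_xy.
rewrite eqEcard cardS cardsE (card_uniqP t_uniq) size_tuple leqnn andbT.
by apply/subsetP => x; rewrite inE => /tS.
Qed.

(** * Weighted solutions of x + y + z = 0 *)

Section ZeroSum.

Variable R : finZmodType.
Implicit Types F G H : R -> nat.

(** Weights in place of sets make the count trilinear, so that it can be
    expanded over a disjoint union of classes. *)
Definition zero_sum F G H : nat :=
  (\sum_(x : R) \sum_(y : R) F x * G y * H (- (x + y))%R)%N.

Lemma eq_zero_sum F F' G G' H H' :
  F =1 F' -> G =1 G' -> H =1 H' -> zero_sum F G H = zero_sum F' G' H'.
Proof.
move=> eF eG eH; apply: eq_bigr => x _; apply: eq_bigr => y _.
by rewrite eF eG eH.
Qed.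

Lemma zero_sum_swap12 F G H : zero_sum F G H = zero_sum G F H.
Proof.
rewrite /zero_sum exchange_big; apply: eq_bigr => x _; apply: eq_bigr => y _.
by rewrite addrC (mulnC (F y)).
Qed.

Lemma zero_sum_swap23 F G H : zero_sum F G H = zero_sum F H G.
Proof.
apply: eq_bigr => x _.
have invK : involutive (fun y => - (x + y)).
  by move=> y /=; rewrite opprD opprK addKr.
rewrite (reindex_inj (inv_inj invK)); apply: eq_bigr => y _ /=.
by rewrite (invK y) mulnAC.
Qed.

Lemma zero_sumDr F G H H' :
  zero_sum F G (fun x => H x + H' x)%N = (zero_sum F G H + zero_sum F G H')%N.
Proof.
rewrite -big_split; apply: eq_bigr => x _; rewrite -big_split.
by apply: eq_bigr => y _; rewrite mulnDr.
Qed.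

Lemma zero_sum_cube F G (s := fun x => (F x + G x)%N) :
  zero_sum s s s =
  (zero_sum F F F + 3 * zero_sum F F G + 3 * zero_sum F G G
    + zero_sum G G G)%N.
Proof.
have expand A B : zero_sum A B s = (zero_sum A B F + zero_sum A B G)%N.
  exact: zero_sumDr.
rewrite expand !(zero_sum_swap23 s s) !expand.
rewrite !(zero_sum_swap12 s) !(zero_sum_swap23 _ s) !expand.
rewrite (zero_sum_swap23 F G F) (zero_sum_swap12 G F F) (zero_sum_swap23 F G F).
rewrite (zero_sum_swap12 G F G) (zero_sum_swap23 G G F) (zero_sum_swap12 G F G).
lia.
Qed.

Definition indic (A : {set R}) (x : R) : nat := x \in A.

Lemma sum_indic (A : {set R}) : (\sum_x indic A x = #|A|)%N.
Proof.
rewrite -sum1_card [RHS]big_mkcond; apply: eq_bigr => x _.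
by rewrite /indic; case: (x \in A).
Qed.

(** Ordered triangles of a Cayley graph: the third difference x - z is the sum
    of the other two, and its sign is immaterial since S = -S. *)
Lemma card_tuple3_zero_sum (S : {set R}) :
    (forall x, (- x \in S) = (x \in S)) ->
  #|[set t : 3.-tuple R | pairwise (fun x y => x - y \in S) t]| =
  (#|R| * zero_sum (indic S) (indic S) (indic S))%N.
Proof.
move=> SN.
(* The base point and the two successive differences determine the tuple. *)
pose h (t : R * (R * R)) : 3.-tuple R :=
  [tuple t.1; t.1 - t.2.1; t.1 - t.2.1 - t.2.2].
have h_bij : bijective h.
  exists (fun t : 3.-tuple R =>
    (t`_0, (t`_0 - t`_1, t`_1 - t`_2))) => [[x [u v]]|t] /=.
    by rewrite !subKr.
  case/tupleP: t => x t; case/tupleP: t => y t; case/tupleP: t => z t.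
  by apply: val_inj; rewrite /= (tuple0 t) /= !subKr.
rewrite -sum1_card big_mkcond (reindex h) /=; last exact: onW_bij.
rewrite -(pair_bigA _ (fun x w => if h (x, w) \in _ then 1 else 0)%N) /=.
rewrite -sum_nat_const; apply: eq_bigr => x _.
rewrite -(pair_bigA _ (fun u v => if h (x, (u, v)) \in _ then 1 else 0)%N) /=.
apply: eq_bigr => u _; apply: eq_bigr => v _.
rewrite inE /= !andbT !subKr -[x - u - v]addrA -opprD subKr -andbA /indic SN.
by case: (u \in S); case: (v \in S); case: (u + v \in S).
Qed.

End ZeroSum.

(** * Quartic classes of units *)

Section QuarticClasses.

Variables (R : finComUnitRingType) (g : {unit R}).

(** Indexing by all natural numbers, with period 4, lets the shift by g be
    written i.+1. *)
Definition quartic_class (i : nat) : {set R} :=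
  [set val u | u in (g ^+ i *: <[g ^+ 4]>)%g].

Hypothesis g_gen : <[g]>%g = [set: {unit R}].
Hypothesis order8 : (8 %| #[g]%g)%N.

Let order4 : (4 %| #[g]%g)%N. Proof. exact: dvdn_trans order8. Qed.

Let unitXP x : x \is a GRing.unit -> exists k, x = val (g ^+ k)%g.
Proof.
move=> x_unit; have : FinRing.Unit x_unit \in <[g]>%g by rewrite g_gen inE.
by case/cycleP => k eq_k; exists k; rewrite -eq_k.
Qed.

(** The exponent of a power of g is only defined modulo the order of g, but its
    residue modulo 4 is, since 4 divides that order. *)
Lemma mem_quartic_class i k :
  (val (g ^+ k)%g \in quartic_class i) = (k == i %[mod 4]).
Proof.
rewrite mem_imset; last exact: val_inj.
have coset_mod j : (g ^+ j *: <[g ^+ 4]> = g ^+ (j %% 4) *: <[g ^+ 4]>)%g.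
  rewrite {1}(divn_eq j 4) addnC expgD lcosetM; congr (_ *: _)%g.
  by rewrite mulnC expgM lcoset_id // mem_cycle.
apply/idP/eqP => [|eq_ki]; last first.
  by rewrite coset_mod -eq_ki -coset_mod lcoset_refl.
case/lcosetP => _ /cycleP[m ->]; rewrite -expgM -expgD => /eqP.
rewrite eq_expg_mod_order => /eqP eq_mod.
by rewrite -(modn_dvdm k order4) eq_mod modn_dvdm // mulnC addnC modnMDl.
Qed.

Lemma quartic_class_unit i x : x \in quartic_class i -> x \is a GRing.unit.
Proof. by case/imsetP => u _ ->; apply: valP. Qed.

Lemma quartic_class_shift i x :
  (val g * x \in quartic_class i.+1) = (x \in quartic_class i).
Proof.
have [/unitXP[k ->]|x_nunit] := boolP (x \is a GRing.unit).
  have -> : val g * val (g ^+ k)%g = val (g ^+ k.+1)%g by rewrite expgS.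
  by rewrite !mem_quartic_class -addn1 -(addn1 i) eqn_modDr.
by apply/idP/idP => /quartic_class_unit;
  rewrite ?(unitrMr _ (valP g)) (negPf x_nunit).
Qed.

Lemma quartic_class_mod4 i j :
  i = j %[mod 4] -> quartic_class i = quartic_class j.
Proof.
move=> eq_ij; apply/setP => x.
have [/unitXP[k ->]|x_nunit] := boolP (x \is a GRing.unit).
  by rewrite !mem_quartic_class eq_ij.
by apply/idP/idP => /quartic_class_unit; rewrite (negPf x_nunit).
Qed.

Lemma sum_indic_quartic_class x :
  (\sum_(i < 4) indic (quartic_class i) x = (x \is a GRing.unit))%N.
Proof.
have [/unitXP[k ->]|x_nunit] := boolP (x \is a GRing.unit); last first.
  rewrite big1 // => i _; rewrite /indic; case: (boolP (x \in _)) => //.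
  by move/quartic_class_unit; rewrite (negPf x_nunit).
rewrite (eq_bigr (fun i : 'I_4 => ((k %% 4)%N == i) : nat)); last first.
  by move=> i _; rewrite /indic mem_quartic_class (modn_small (ltn_ord i)).
have := ltn_pmod k (isT : 0 < 4)%N; rewrite !big_ord_recr big_ord0 /=.
by case: (k %% 4)%N => [|[|[|[|]]]].
Qed.

Lemma quartic_class_mulr i x y : y \in quartic_class 0 ->
  (x * y \in quartic_class i) = (x \in quartic_class i).
Proof.
move=> y0; have /unitXP[m eq_y] := quartic_class_unit y0.
move: y0; rewrite eq_y mem_quartic_class => /eqP m0.
have [/unitXP[k ->]|x_nunit] := boolP (x \is a GRing.unit).
  have -> : val (g ^+ k)%g * val (g ^+ m)%g = val (g ^+ (k + m))%g.
    by rewrite expgD.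
  by rewrite !mem_quartic_class -modnDmr m0 addn0.
by apply/idP/idP => /quartic_class_unit;
  rewrite ?(unitrMl _ (valP (g ^+ m)%g)) (negPf x_nunit).
Qed.

(** If -1 = g^k then the order of g divides 2k, hence so does 8. *)
Lemma quartic_classN1 : -1 \in quartic_class 0.
Proof.
have /unitXP[k eq_k] : (-1 : R) \is a GRing.unit by rewrite unitrN1.
have : (g ^+ (k * 2) == 1)%g.
  by rewrite expgM -val_eqE /= -eq_k mulrNN mulr1.
rewrite -order_dvdn => /(dvdn_trans order8).
by rewrite (@dvdn_pmul2r 2 4) // eq_k mem_quartic_class mod0n => /eqP->.
Qed.

Lemma quartic_classN i x : (- x \in quartic_class i) = (x \in quartic_class i).
Proof. by rewrite -mulrN1 quartic_class_mulr // quartic_classN1. Qed.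

Lemma card_quartic_class i : (#|quartic_class i| * 4 = #[g]%g)%N.
Proof.
rewrite card_imset; last exact: val_inj.
by rewrite card_lcoset -orderE orderXdiv // divnK.
Qed.

(** ** Counting zero-sum triples by classes *)

Local Notation nonunits := [set x : R | x \isn't a GRing.unit].
Hypothesis nonunitsD : {in nonunits &, forall x y, x + y \in nonunits}.
Hypothesis odd_nonunits : odd #|nonunits|.

(** The nonunits form an ideal J, so 1 + J is a group of units of odd order
    #|J|; an element g^k of odd order has 4 dividing k. *)
Lemma one_plus_nonunit x : x \in nonunits -> 1 + x \in quartic_class 0.
Proof.
pose K : {set {unit R}} := [set u | val u - 1 \in nonunits].
have nonunitsM y z : y \in nonunits -> y * z \in nonunits.
  by rewrite !inE; apply: contra; rewrite unitrM => /andP[].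
have nonunits1D y : y \in nonunits -> 1 + y \is a GRing.unit.
  move=> yN; apply: contraT => y1N.
  have := @nonunitsD (1 + y) (y * -1); rewrite mulrN1 addrK !inE unitr1.
  by move/(_ y1N); apply; have := nonunitsM y (-1) yN; rewrite mulrN1 inE.
have groupK : group_set K.
  apply/group_setP; split; first by rewrite !inE /= subrr unitr0.
  move=> u v; rewrite inE => uK; rewrite inE => vK; rewrite inE /=.
  have -> : val u * val v - 1 = (val u - 1) * val v + (val v - 1) by ring.
  by apply: nonunitsD => //; apply: nonunitsM.
have cardK : #|K| = #|nonunits|.
  rewrite -(card_imset (mem K) val_inj) -(card_imset (mem nonunits) (addrI 1)).
  apply: eq_card => y; apply/imsetP/imsetP => [[u]|[z zN ->]].
    by rewrite inE => uK ->; exists (val u - 1) => //; rewrite subrKC.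
  exists (FinRing.Unit (nonunits1D z zN)) => //.
  by rewrite inE /= addrAC subrr add0r.
move=> xN; pose u := FinRing.Unit (nonunits1D x xN).
have uK : u \in Group groupK by rewrite inE /= addrAC subrr add0r.
have u_odd : odd #[u]%g.
  by apply: dvdn_odd odd_nonunits; rewrite -cardK; apply: (order_dvdG uK).
have /unitXP[k eq_k] := nonunits1D x xN.
rewrite eq_k mem_quartic_class mod0n.
have : (g ^+ (k * #[u]) == 1)%g.
  rewrite expgM; have -> : (g ^+ k = u)%g by apply: val_inj; rewrite -eq_k.
  by rewrite expg_order.
rewrite -order_dvdn => /(dvdn_trans order4).
by rewrite Gauss_dvdl // (@coprimeXl 2 2) // coprime2n.
Qed.

Definition class_triples i j k := zero_sum (indic (quartic_class i))
  (indic (quartic_class j)) (indic (quartic_class k)).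

Lemma class_triples_shift i j k :
  class_triples i.+1 j.+1 k.+1 = class_triples i j k.
Proof.
have g_inj : injective ( *%R (val g)) by apply: mulrI; apply: (valP g).
rewrite /class_triples /zero_sum (reindex_inj g_inj); apply: eq_bigr => x _.
rewrite (reindex_inj g_inj); apply: eq_bigr => y _ /=.
by rewrite -mulrDr -mulrN /indic !quartic_class_shift.
Qed.

(** Summing over k leaves the pairs with x + y a unit.  If x + y is a nonunit
    then y = - x (1 - (x + y) / x) has the class of x, so the excluded pairs
    exist only for equal classes, where x has one partner per nonunit. *)
Lemma sum_class_triples i j :
  (\sum_(k < 4) class_triples i j k
      + (i == j %[mod 4]) * (#|quartic_class i| * #|nonunits|)
    = #|quartic_class i| * #|quartic_class j|)%N.
Proof.
have -> : (\sum_(k < 4) class_triples i j k =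
   \sum_x \sum_y indic (quartic_class i) x * indic (quartic_class j) y
                 * (- (x + y)%R \is a GRing.unit))%N.
  rewrite exchange_big; apply: eq_bigr => x _.
  rewrite exchange_big; apply: eq_bigr => y _.
  by rewrite -sum_indic_quartic_class big_distrr.
rewrite -!sum_indic !big_distrl big_distrr -big_split; apply: eq_bigr => x _ /=.
rewrite [in RHS]big_distrr.
rewrite /indic; case: (boolP (x \in quartic_class i)) => xi; last first.
  by rewrite !mul0n muln0 big1 // ?addn0 big1.
rewrite !mul1n.
have -> : ((i == j %[mod 4]) * \sum_y (y \in nonunits) =
    \sum_y (y \in quartic_class j) * (- (x + y)%R \isn't a GRing.unit))%N.
  have xu := quartic_class_unit xi.
  rewrite (reindex_inj (addrI x)) big_distrr; apply: eq_bigr => y _ /=.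
  rewrite unitrN inE.
  case: (boolP (x + y \is a GRing.unit)) => [|xyN]; rewrite ?muln0 //= !muln1.
  congr nat_of_bool.
  have -> : y = - x * (1 + - ((x + y) / x)).
    by rewrite mulrDr mulr1 mulrNN mulrCA divrr // mulr1 addKr.
  rewrite quartic_class_mulr ?quartic_classN; last first.
    by rewrite one_plus_nonunit // inE unitrN unitrM unitrV xu andbT.
  have /unitXP[k eq_k] := xu; move: xi.
  by rewrite eq_k !mem_quartic_class => /eqP->.
rewrite -big_split; apply: eq_bigr => y _ /=.
by rewrite !mul1n; case: (y \in _) => //=; case: (- _ \is a _).
Qed.

(** Up to symmetry and shift only five of the class counts are distinct, and
    although the three relations between them leave two degrees of freedom,
    they determine the combination needed here. *)
Lemma zero_sum_peisert (S := quartic_class 0 :|: quartic_class 1)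
    (f := #|quartic_class 0|) :
  (zero_sum (indic S) (indic S) (indic S) + 2 * (f * #|nonunits|)
    = 2 * (f * f))%N.
Proof.
have indicS x :
    indic S x = (indic (quartic_class 0) x + indic (quartic_class 1) x)%N.
  have := sum_indic_quartic_class x.
  rewrite /indic inE !big_ord_recr big_ord0 /=.
  by case: (x \in _); case: (x \in _); case: (_ \is a _).
have cardE i : #|quartic_class i| = f.
  by apply/eqP; rewrite -(@eqn_pmul2r 4) // !card_quartic_class.
have T12 i j k : class_triples i j k = class_triples j i k.
  exact: zero_sum_swap12.
have T23 i j k : class_triples i j k = class_triples i k j.
  exact: zero_sum_swap23.
have T4 i j k : class_triples i j k.+4 = class_triples i j k.
  by rewrite /class_triples (@quartic_class_mod4 k.+4 k) // -addn4 modnDr.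
rewrite (eq_zero_sum indicS indicS indicS) zero_sum_cube.
rewrite -!/(class_triples _ _ _).
have shift := class_triples_shift.
have e111 : class_triples 1 1 1 = class_triples 0 0 0 by exact: shift.
have e011 : class_triples 0 1 1 = class_triples 0 0 3.
  by rewrite -[RHS]shift [RHS]T4 [RHS]T23 [RHS]T12.
have e013 : class_triples 0 1 3 = class_triples 0 1 2.
  by rewrite -[LHS]shift [LHS]T4 [LHS]T23 [LHS]T12.
have e022 : class_triples 0 2 2 = class_triples 0 0 2.
  by rewrite -[RHS]shift -[RHS]shift [RHS]T4 [RHS]T23 [RHS]T12.
have e023 : class_triples 0 2 3 = class_triples 0 1 2.
  by rewrite -e013 -[LHS]shift [LHS]T4 [LHS]T23 [LHS]T12.
have := (sum_class_triples 0 0, sum_class_triples 0 1, sum_class_triples 0 2).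
rewrite !big_ord_recr !big_ord0 /= !cardE e111 e011 e013 e022 e023.
rewrite (T23 0 1 0)%N (T23 0 2 0)%N (T23 0 2 1)%N.
move=> [[]]; lia.
Qed.

Lemma triangles_peisert (S := quartic_class 0 :|: quartic_class 1)
    (f := #|quartic_class 0|) :
  (nb_cliques (fun x y : R => (x - y)%R \in S) 3 * 6
     + #|R| * (2 * (f * #|nonunits|)) = #|R| * (2 * (f * f)))%N.
Proof.
have SN x : (- x \in S) = (x \in S) by rewrite !inE !quartic_classN.
have S_sym : symmetric (fun x y : R => x - y \in S).
  by move=> x y /=; rewrite -SN opprB.
have S_irr : irreflexive (fun x y : R => x - y \in S).
  move=> x /=; rewrite subrr inE.
  by apply/orP => -[] /quartic_class_unit; rewrite unitr0.
have := card_ordered_cliques 3 S_sym S_irr.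
rewrite card_tuple3_zero_sum // => <-.
by rewrite -mulnDr zero_sum_peisert.
Qed.

End QuarticClasses.

(** * The ring of integers modulo a prime power *)

Theorem theorem3p1 (p a : nat) (p_prime : prime p)
    (p_mod8 : p = 1 %[mod 8]) (a_gt0 : (0 < a)%N)
    (g : {unit 'Z_(p ^ a)}) (g_gen : generator (units_Zp (p ^ a)) g) :
  (nb_cliques (peisert_like g) 3)%:R =
    p%:R ^+ (3 * a - 2) * (p%:R - 1) * (p%:R - 5) / 48 :> rat.
Proof.
have [b eq_a] : exists b, a = b.+1 by exists a.-1; rewrite prednK.
have p_gt1 := prime_gt1 p_prime.
have n_gt1 : (1 < p ^ a)%N by rewrite -{1}(expn0 p) ltn_exp2l.
have [r eq_p] : exists r, p = (8 * r + 1)%N.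
  by exists (p %/ 8)%N; rewrite {1}(divn_eq p 8) p_mod8 mulnC.
have eq_n : (p ^ a = (8 * r + 1) * p ^ b)%N by rewrite eq_a expnS {1}eq_p.
have gE : <[g]>%g = [set: {unit 'Z_(p ^ a)}] by rewrite -(eqP g_gen).
have ordg : #[g]%g = (8 * r * p ^ b)%N.
  rewrite orderE gE (@card_units_Zp (p ^ a)) ?(ltnW n_gt1) // eq_a.
  by rewrite totient_pfactor // eq_p addn1.
have unitE (x : 'Z_(p ^ a)) : (x \is a GRing.unit) = ~~ (p %| x)%N.
  by rewrite -{1}(natr_Zp x) unitZpE // coprime_pexpl // prime_coprime.
have p_dvd_mod m : (p %| m %% p ^ a)%N = (p %| m)%N.
  by rewrite /dvdn modn_dvdm // dvdn_exp.
pose N := [set x : 'Z_(p ^ a) | x \isn't a GRing.unit].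
have ND : {in N &, forall x y, x + y \in N}.
  move=> x y; rewrite !inE !unitE !negbK => px py /=.
  by rewrite {3}Zp_cast // p_dvd_mod dvdn_add.
have cardR : #|'Z_(p ^ a)| = (p ^ a)%N by rewrite card_ord Zp_cast.
have cardN : #|N| = (p ^ b)%N.
  have := cardsC N; rewrite cardR.
  have -> : #|~: N| = #[g]%g.
    rewrite orderE gE -(card_imset _ val_inj); apply: eq_card => x.
    rewrite !inE negbK; apply/idP/imsetP => [xu|[u _ ->]]; last exact: valP.
    by exists (FinRing.Unit xu).
  move=> eqN; have := etrans eqN eq_n.
  by rewrite ordg mulnDl mul1n addnC => /addnI.
have order8 : (8 %| #[g]%g)%N by rewrite ordg -mulnA dvdn_mulr.
have oddN : odd #|N| by rewrite cardN oddX eq_p; lia.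
have eS : quartic_class g 0 :|: quartic_class g 1 = peisert_set g.
  by rewrite /peisert_set imsetU /quartic_class expg0 lcoset1 expg1.
have cardC : #|quartic_class g 0| = (2 * r * p ^ b)%N.
  have := card_quartic_class order8 0; rewrite ordg; lia.
have := triangles_peisert gE order8 ND oddN.
rewrite -/N eS cardN cardC cardR -/(peisert_like g).
move/(congr1 (fun m => m%:R : rat)).
rewrite !(natrD, natrM, natrX).
have -> : (3 * a - 2 = 1 + b * 3)%N by lia.
have -> : (p%:R : rat) ^+ a = p%:R * p%:R ^+ b by rewrite eq_a exprS.
have -> : (p%:R : rat) ^+ (1 + b * 3) = p%:R * (p%:R ^+ b) ^+ 3.
  by rewrite exprD expr1 exprM.
have -> : (p%:R : rat) = 8 * r%:R + 1 by rewrite eq_p natrD natrM.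
move: (nb_cliques _ _)%:R (r%:R : rat) (_ ^+ b) => k x q eq_k.
have {eq_k} -> : k = (8 * x + 1) * (8 * x ^+ 2 - 4 * x) * q ^+ 3 / 6 by lra.
by field.
Qed.
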